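(* Let $\mathcal A=\{1,2,\dots,|\mathcal A|\}$ be the set of values of a multi-class protected attribute $A$, let $p_a=\mathbb P(A=a)$ for $a\in\mathcal A$, and suppose that for all $a\in\mathcal A$, $\eta_a(X)$ has a probability density function when $X\sim\mathbb P_{X\mid A=a}$. Then there are constants $(t_{\mathrm{DD},a})_{a=1}^{|\mathcal A|}$ with $\sum_{a=1}^{|\mathcal A|}t_{\mathrm{DD},a}=0$ such that, for all $a\in\{2,\dots,|\mathcal A|\}$, $$\mathbb P_{X\mid A=a}\Big(\eta_a(X)>\tfrac12+\tfrac{t_{\mathrm{DD},a}}{2p_a}\Big)=\mathbb P_{X\mid A=1}\Big(\eta_1(X)>\tfrac12+\tfrac{t_{\mathrm{DD},1}}{2p_1}\Big).$$ Moreover, there is a fair Bayes-optimal classifier (under perfect demographic parity) such that for all $x,a$, $$f_{\mathrm{DD},t_{\mathrm{DD},1},\dots,t_{\mathrm{DD},|\mathcal A|}}(x,a)=I\Big(\eta_a(x)>\tfrac12+\tfrac{t_{\mathrm{DD},a}}{2p_a}\Big).$$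
   Context: $(X,A,Y)\sim\mathbb P$ is a random triple with values in $\mathcal X\times\mathcal A\times\{0,1\}$, with $|\mathcal A|>2$ and all $p_a>0$; $\eta_a(x)=\mathbb P(Y=1\mid A=a,X=x)$; $\mathbb P_{X\mid A=a}$ is the conditional law of $X$ given $A=a$; $I(\cdot)$ is the indicator function. A (randomized) classifier is a measurable $f:\mathcal X\times\mathcal A\to[0,1]$; $\mathcal F$ is the set of all of them. Its prediction satisfies $\widehat Y_f\mid X=x,A=a\sim\mathrm{Bernoulli}(f(x,a))$, conditionally independent of $Y$ given $(X,A)$. A classifier satisfies perfect demographic parity if $\mathbb P(\widehat Y_f=1\mid A=a)=\mathbb P(\widehat Y_f=1\mid A=1)$ for $a=2,\dots,|\mathcal A|$. A fair Bayes-optimal classifier is any minimizer of the misclassification error $\mathbb P(Y\ne\widehat Y_f)$ over all $f\in\mathcal F$ satisfying perfect demographic parity. *)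

(* Defs.v *)
From HB Require Import structures.
From mathcomp Require Import all_boot all_order all_algebra.
From mathcomp Require Import all_classical all_reals all_analysis.

Set Implicit Arguments.
Unset Strict Implicit.
Unset Printing Implicit Defensive.
Import Order.TTheory GRing.Theory Num.Theory.
Import numFieldNormedType.Exports.

Local Open Scope classical_set_scope.
Local Open Scope ring_scope.

HB.instance Definition _ (n : nat) := isPointed.Build 'I_n.+1 ord0.

HB.instance Definition _ (n : nat) :=
  @isMeasurable.Build default_measure_display 'I_n.+1
    (@discrete_measurable 'I_n.+1) discrete_measurable0
    (@discrete_measurableC 'I_n.+1) (@discrete_measurableU 'I_n.+1).

(* Elementary conditional probability mu(E | F); only meaningful when
   mu F is neither 0 nor infinite. *)
Definition cond_prob (R : realType) (T : Type) (mu : set T -> \bar R)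
    (E F : set T) : R :=
  fine (mu (E `&` F)) / fine (mu F).

Definition has_pdf (R : realType) (nu : set R -> R) : Prop :=
  exists g : R -> R,
    [/\ measurable_fun [set: R] g,
        forall y, 0 <= g y &
        forall B : set R, measurable B ->
          (nu B)%:E = (\int[lebesgue_measure]_(y in B) (g y)%:E)%E].

(* Throughout, P is the law of the triple (X, A, Y) on 𝒳 * 𝒜 * {0, 1}, where
   'I_n.+1 stands for 𝒜 = {1, ..., n + 1} with the labels shifted by one:
   ord0 is the reference group 1, and a != ord0 means a in {2, ..., |𝒜|}.
   A point of the space is written z = ((x, a), y). *)

Definition group_prob (R : realType) (d : measure_display)
    (X : measurableType d) (n : nat)
    (P : probability (X * 'I_n.+1 * bool)%type R) (a : 'I_n.+1) : R :=
  fine (P [set z | z.1.2 = a]).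

(* P_{X | A = a} *)
Definition cond_law (R : realType) (d : measure_display)
    (X : measurableType d) (n : nat)
    (P : probability (X * 'I_n.+1 * bool)%type R) (a : 'I_n.+1)
    (B : set X) : R :=
  cond_prob P [set z | B z.1.1] [set z | z.1.2 = a].

(* eta a x = P(Y = 1 | A = a, X = x): any version of the conditional
   probability of {Y = 1} given (X, A). *)
Definition is_regression (R : realType) (d : measure_display)
    (X : measurableType d) (n : nat)
    (P : probability (X * 'I_n.+1 * bool)%type R)
    (eta : 'I_n.+1 -> X -> R) : Prop :=
  [/\ measurable_fun [set: X * 'I_n.+1] (fun xa => eta xa.2 xa.1),
      P.-integrable setT (fun z => (eta z.1.2 z.1.1)%:E) &
      forall G : set (X * 'I_n.+1), measurable G ->
        P [set z | G z.1 /\ z.2 = true] =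
        (\int[P]_(z in [set z | G z.1]) (eta z.1.2 z.1.1)%:E)%E].

Definition classifier (R : realType) (d : measure_display)
    (X : measurableType d) (n : nat) : set (X * 'I_n.+1 -> R) :=
  [set f : X * 'I_n.+1 -> R |
    measurable_fun setT f /\ forall xa, 0 <= f xa <= 1].

(* Joint law of ((X, A, Y), Yhat_f).  The Bernoulli(f (x, a)) kernel does not
   depend on y, which encodes the conditional independence of Yhat_f and Y
   given (X, A).  The unit argument is the trivial parameter of the library's
   parameterized product of kernels. *)
Definition pred_law (R : realType) (d : measure_display)
    (X : measurableType d) (n : nat)
    (P : probability (X * 'I_n.+1 * bool)%type R)
    (f : X * 'I_n.+1 -> R) : set (X * 'I_n.+1 * bool * bool) -> \bar R :=
  kproduct_snd
    (fun _ : unit => P : {measure set (X * 'I_n.+1 * bool) -> \bar R})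
    (fun z => bernoulli_prob (f z.1) : {measure set bool -> \bar R}) tt.

Definition demographic_parity (R : realType) (d : measure_display)
    (X : measurableType d) (n : nat)
    (P : probability (X * 'I_n.+1 * bool)%type R)
    (f : X * 'I_n.+1 -> R) : Prop :=
  forall a : 'I_n.+1, a != ord0 ->
    cond_prob (pred_law P f) [set w | w.2 = true] [set w | w.1.1.2 = a] =
    cond_prob (pred_law P f) [set w | w.2 = true] [set w | w.1.1.2 = ord0].

(* P(Y <> Yhat_f) *)
Definition misclassification (R : realType) (d : measure_display)
    (X : measurableType d) (n : nat)
    (P : probability (X * 'I_n.+1 * bool)%type R)
    (f : X * 'I_n.+1 -> R) : \bar R :=
  pred_law P f [set w | w.1.2 <> w.2].

Definition fair_bayes_optimal (R : realType) (d : measure_display)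
    (X : measurableType d) (n : nat)
    (P : probability (X * 'I_n.+1 * bool)%type R)
    (f : X * 'I_n.+1 -> R) : Prop :=
  [/\ classifier f, demographic_parity P f &
      forall g : X * 'I_n.+1 -> R, classifier g -> demographic_parity P g ->
        (misclassification P f <= misclassification P g)%E].

(* Main.v *)
(* Write [G_a t] for the probability, given [A = a], that [eta_a] exceeds
   [1/2 + t / (2 p_a)].  Having a density makes every [G_a] continuous, and
   [G_a] decreases from 1 to 0.  For two such functions and any [s], the
   intermediate value theorem applied to [t |-> G_1 t - G_2 (s - t)] gives a
   common value of [G_1] and [G_2] at points of sum [s]; as a function of [s],
   this value is again continuous and decreasing, so induction on the number of
   groups yields thresholds [t_a] of sum [0] at which all the [G_a] agree.

   Since [eta] is a version of [P(Y = 1 | A, X)], the risk of [g] is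
   [E Y + E (g (1 - 2 eta))].  Under demographic parity
   [E (g t_A / p_A) = (\sum_a t_a) r = 0], where [r] is the common rate of [g],
   so the risk is also [E Y + E (g (1 - 2 eta + t_A / p_A))], which is minimized
   pointwise by the indicator of [eta_A > 1/2 + t_A / (2 p_A)]. *)

Require Import Defs.
From HB Require Import structures.
From mathcomp Require Import all_boot all_order all_algebra.
From mathcomp Require Import all_classical all_reals all_analysis.
From mathcomp Require Import measurable_realfun ring lra.

Set Implicit Arguments.
Unset Strict Implicit.
Unset Printing Implicit Defensive.
Import Order.TTheory GRing.Theory Num.Theory.
Import numFieldNormedType.Exports.
Import HBNNSimple.

Local Open Scope classical_set_scope.
Local Open Scope ring_scope.

(** * Decreasing continuous functions and their common levels *)

(** Crossing one fixed level [c] stands in for the limits 1 and 0: it suffices for the intermediate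
    value theorem and is inherited, with the same [c], when functions are combined. *)
Definition descends_through (R : realType) (c : R) (G : R -> R) : Prop :=
  [/\ continuous G, nonincreasing_fun G,
      exists t, c <= G t & exists t, G t <= c].

(* [H] is the inf-convolution analogue for level sets: its generalized inverse
   is the sum of the generalized inverses of [G1] and [G2]. *)
Lemma descends_through_level2 (R : realType) (c : R) (G1 G2 : R -> R) :
  descends_through c G1 -> descends_through c G2 ->
  exists2 H : R -> R, descends_through c H &
    forall s, exists t1 t2, [/\ t1 + t2 = s, G1 t1 = H s & G2 t2 = H s].
Proof.
move=> [cG1 dG1 [l1 hl1] [u1 hu1]] [cG2 dG2 [l2 hl2] [u2 hu2]].
have split s : exists t, G1 t = G2 (s - t).
  (* Here [a <= l1] and [u2 <= s - a], so [G2 (s - a) <= c <= G1 a]; at [b] the inequalities are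
     reversed. *)
  pose a := Num.min l1 (s - u2); pose b := Num.max u1 (s - l2).
  pose D := fun t => G1 t - G2 (s - t).
  have cD : continuous D.
    move=> t; apply: (@continuousB _ R^o); first exact: cG1.
    apply: (@continuous_comp _ _ _ (fun t => s - t) G2); last exact: cG2.
    apply: (@continuousB _ R^o); first exact: cst_continuous.
    by move=> ?; exact: cvg_id.
  have Da : 0 <= D a.
    rewrite subr_ge0 (@le_trans _ _ c)//.
      apply: le_trans hu2; apply: dG2.
      by rewrite lerBrDl -lerBrDr ge_min lexx orbT.
    by apply: le_trans hl1 _; apply: dG1; rewrite ge_min lexx.
  have Db : D b <= 0.
    rewrite subr_le0 (@le_trans _ _ c)//.
      by apply: le_trans hu1; apply: dG1; rewrite le_max lexx.
    apply: le_trans hl2 _; apply: dG2.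
    by rewrite lerBlDl -lerBlDr le_max lexx orbT.
  (* If [b < a], monotonicity of [D] gives [D a <= D b <= 0 <= D a], so [a] itself is a zero. *)
  have [ab|ba] := leP a b; last first.
    have DD : D a <= D b.
      rewrite lerD//; first by apply: dG1; exact: ltW.
      by rewrite lerN2; apply: dG2; rewrite lerD2l lerN2 ltW.
    exists a; apply/eqP; rewrite -subr_eq0; apply/eqP/le_anti.
    by rewrite -/(D a) Da (le_trans DD).
  have D0 : Num.min (D a) (D b) <= 0 <= Num.max (D a) (D b).
    by rewrite ge_min Db orbT le_max Da.
  have [t _ Dt] := IVT ab (continuous_subspaceT cD) D0.
  by exists t; apply/eqP; rewrite -subr_eq0; exact/eqP.
have [t ht] := choice split.
exists (fun s => G1 (t s)); last first.
  by move=> s; exists (t s), (s - t s); rewrite addrC subrK -ht.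
(* The selector [t] need be neither continuous nor monotone. But [t s + k1] and [s - t s + k2] add
   up to [s'], as do [t s'] and [s' - t s'], so one coordinate of the latter pair is at most its
   counterpart in the former. This bounds the level at [s'] from below, and [comp'] bounds it from
   above. *)
have comp s s' k1 k2 : k1 + k2 = s' - s ->
    G1 (t s + k1) <= G1 (t s') \/ G2 (s - t s + k2) <= G1 (t s').
  move=> k12; have [tt|tt] := leP (t s') (t s + k1); first by left; exact: dG1.
  by right; rewrite ht; apply: dG2; lra.
have comp' s s' k1 k2 : k1 + k2 = s' - s ->
    G1 (t s') <= G1 (t s + k1) \/ G1 (t s') <= G2 (s - t s + k2).
  move=> k12; have [tt|tt] := leP (t s + k1) (t s'); first by left; exact: dG1.
  by right; rewrite ht; apply: dG2; lra.
split.
- move=> s; apply/(@cvgrPdist_lt _ R^o) => e e0.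
  have /(@cvgrPdist_lt _ R^o) /(_ e e0) /nbhs_ballP[d1 /= d10 H1] := cG1 (t s).
  have /(@cvgrPdist_lt _ R^o) /(_ e e0) /nbhs_ballP[d2 /= d20 H2] := cG2 (s - t s).
  apply/nbhs_ballP; exists (Num.min d1 d2); first by rewrite /= lt_min d10.
  move=> s' /=; rewrite /ball/= lt_min => /andP[s1 s2].
  have B1 : `|G1 (t s) - G1 (t s + (s' - s))| < e.
    by apply: H1; rewrite /ball/= opprD addNKr normrN distrC.
  have B2 : `|G1 (t s) - G2 (s - t s + (s' - s))| < e.
    by rewrite ht; apply: H2; rewrite /ball/= opprD addNKr normrN distrC.
  have B0 : `|G1 (t s) - G1 (t s + 0)| < e by rewrite addr0 subrr normr0.
  have B0' : `|G1 (t s) - G2 (s - t s + 0)| < e by rewrite addr0 ht subrr normr0.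
  move: B1 B2 B0 B0'; rewrite !ltr_norml => /andP[a1 b1] /andP[a2 b2].
  move=> /andP[a3 b3] /andP[a4 b4].
  (* The whole increment goes to the first coordinate: the shifted value of [G1] is within [e] of
     the old level, and the unshifted value of [G2] equals it. *)
  have e1 : s' - s + 0 = s' - s by rewrite addr0.
  have h1 := comp s s' _ _ e1; have h2 := comp' s s' _ _ e1.
  by apply/andP; split; [case: h2|case: h1] => ?; lra.
- move=> s s' ss'; have [tt|tt] := leP (t s) (t s'); first exact: dG1.
  by rewrite !ht; apply: dG2; lra.
- exists (l1 + l2); have [tt|tt] := leP (t (l1 + l2)) l1.
    exact/(le_trans hl1)/dG1.
  by rewrite ht; apply/(le_trans hl2)/dG2; lra.
- exists (u1 + u2); have [tt|tt] := leP u1 (t (u1 + u2)).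
    exact/(le_trans _ hu1)/dG1.
  by rewrite ht; apply/(le_trans _ hu2)/dG2; lra.
Qed.

(** The common level of the groups other than [ord0] again descends through [c], so it can be paired
    with [G ord0]. The sum [s] is arbitrary because the induction hypothesis is applied to the share
    [t2] left to those groups. *)
Lemma descends_through_level (R : realType) (c : R) (n : nat)
    (G : 'I_n.+1 -> R -> R) : (forall a, descends_through c (G a)) ->
  exists2 H : R -> R, descends_through c H &
    forall s, exists2 t : 'I_n.+1 -> R,
      \sum_(a < n.+1) t a = s & forall a, G a (t a) = H s.
Proof.
elim: n G => [|n IH] G dG.
  exists (G ord0) => // s; exists (fun=> s); first by rewrite big_ord1.
  by move=> a; rewrite (ord1 a).
have [H' dH' hH'] := IH (fun a => G (lift ord0 a)) (fun a => dG _).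
have [H dH hH] := descends_through_level2 (dG ord0) dH'.
exists H => // s; have [t1 [t2 [<- G1 H2]]] := hH s.
have [t' st' ht'] := hH' t2.
exists (fun a => if unlift ord0 a is Some b then t' b else t1).
  rewrite big_ord_recl unlift_none -st'; congr (_ + _).
  by apply: eq_bigr => b _; rewrite liftK.
by move=> a; case: unliftP => [b ->|->] //; rewrite ht'.
Qed.

(** * Tail probabilities of a law with a density *)

(** Dominated convergence with [g] as dominating function. A general limit set [B] covers continuity
    at a point as well as the limits at both infinities. *)
Lemma pdf_tail_cvg (R : realType) (g : R -> R) (u : nat -> R) (B : set R) :
  measurable_fun [set: R] g -> (forall y, 0 <= g y) ->
  (\int[lebesgue_measure]_y (g y)%:E < +oo)%E -> measurable B ->
  {ae lebesgue_measure, forall y,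
     (fun k => \1_`]u k, +oo[ y : R) @ \oo --> (\1_B y : R)} ->
  (fun k => \int[lebesgue_measure]_(y in `]u k, +oo[) g y) @ \oo -->
  \int[lebesgue_measure]_(y in B) g y.
Proof.
move=> mg g0 gfin mB cvgB.
have ig : lebesgue_measure.-integrable [set: R] (EFin \o g).
  apply/integrableP; split; first exact/measurable_EFinP.
  by under eq_integral do rewrite /= ger0_norm//.
have intE (C : set R) : \int[lebesgue_measure]_(y in C) g y =
    fine (\int[lebesgue_measure]_y (g y * \1_C y)%:E).
  rewrite /Rintegral integral_mkcond; congr fine; apply: eq_integral => y _.
  by rewrite patchE indicE; case: ifP => _; rewrite ?mulr1 ?mulr0.
under eq_fun do rewrite intE.
rewrite intE.
have mgC (C : set R) : measurable C ->
    measurable_fun [set: R] (fun y => (g y * \1_C y)%:E).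
  move=> mC; apply/measurable_EFinP.
  by apply: measurable_funM => //; exact: measurable_indic.
have [|||||/= igB _ cvgI] := @dominated_convergence _ _ _ lebesgue_measure setT
  measurableT (fun k y => (g y * \1_`]u k, +oo[ y)%:E)
  (fun y => (g y * \1_B y)%:E) (EFin \o g) => //.
- by move=> k; exact: mgC.
- exact: mgC.
- apply: (@filterS _ _ (ae_filter_ringOfSetsType lebesgue_measure) _ _ _ cvgB).
  move=> y yB _; apply: cvg_EFin; first exact: nearW.
  by apply: (@cvgM _ _ _ _ (fun=> g y)) => //; exact: cvg_cst.
- apply: aeW => y k _; rewrite /= lee_fin normrM ger0_norm// ler_piMr//.
  by rewrite indicE; case: (_ \in _); rewrite ?normr1 ?normr0.
- apply: fine_cvg; rewrite fineK; first exact: cvgI.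
  exact: integrable_fin_num igB.
Qed.

(** The indicator is eventually constant: once [u k] is closer to [s] than [y] is, both lie on the
    same side of [y]. *)
Lemma indic_tail_cvg (R : realType) (u : nat -> R) (s y : R) :
  u @ \oo --> s -> y != s ->
  (fun k => \1_`]u k, +oo[ y : R) @ \oo --> (\1_`]s, +oo[ y : R).
Proof.
move=> us ys; apply: cvg_near_cst.
have e0 : 0 < `|s - y| by rewrite normr_gt0 subr_eq0 eq_sym.
have /cvgrPdist_lt /(_ _ e0) := us; apply: filterS => k uk.
rewrite !indicE !mem_setE !in_itv/= !andbT; congr ((nat_of_bool _)%:R).
have [ys'|sy|E] := ltgtP y s; last by rewrite E eqxx in ys.
  move: uk; rewrite (gtr0_norm (_ : 0 < s - y)) ?subr_gt0// ltr_norml.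
  by move=> /andP[_ h]; apply/negbTE; rewrite -leNgt; lra.
move: uk; rewrite (ltr0_norm (_ : s - y < 0)) ?subr_lt0// ltr_norml.
by move=> /andP[h _]; lra.
Qed.

Lemma has_pdf_tail_descends (R : realType) (nu : set R -> R) (c : R) :
  has_pdf nu -> nu [set: R] = 1 -> 0 < c < 1 ->
  descends_through c (fun s => nu `]s, +oo[%classic).
Proof.
move=> [g [mg g0 nuE]] nuT /andP[c0 c1].
have nuR B : measurable B -> nu B = \int[lebesgue_measure]_(y in B) g y.
  by move=> mB; rewrite /Rintegral -nuE.
have gfin : (\int[lebesgue_measure]_y (g y)%:E < +oo)%E by rewrite -nuE// ltry.
have cvgnu (u : nat -> R) B : measurable B ->
    {ae lebesgue_measure, forall y : R,
      (fun k => \1_`]u k, +oo[ y : R) @ \oo --> (\1_B y : R)} ->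
    (fun k => nu `]u k, +oo[%classic) @ \oo --> nu B.
  move=> mB cB; under eq_fun do rewrite nuR//.
  by rewrite nuR//; exact: pdf_tail_cvg.
have nu0 : nu set0 = 0 by rewrite nuR// Rintegral_set0.
split.
(* Sequential continuity; pointwise convergence can fail only at [s], a Lebesgue-null set. *)
- move=> s; apply/(@cvg_nbhsP _ R^o) => u us; apply: cvgnu => //.
  exists [set s]; split => //; first exact: lebesgue_measure_set1.
  move=> y /= ny; apply/eqP; apply: contra_notT ny => ys.
  exact: indic_tail_cvg.
- move=> s s' ss'; rewrite -lee_fin !nuE//.
  apply: ge0_subset_integral => //.
  + exact/measurable_EFinP/measurable_funTS.
  + by move=> y _; rewrite lee_fin.
  + by apply: subset_itvr; rewrite bnd_simp.
- have /cvgrPdist_lt : (fun k => nu `](- k%:R : R), +oo[%classic) @ \oo --> nu setT.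
    apply: cvgnu => //; apply: aeW => y; apply: cvg_near_cst.
    have := nbhs_infty_gtr (- y); apply: filterS => k hk.
    by rewrite indicT indicE mem_set//= in_itv/= andbT ltrNl.
  (* A tail within [1 - c] of the total mass 1 exceeds [c]. *)
  move=> /(_ (1 - c)); rewrite subr_gt0 => /(_ c1) [N _ /(_ N (leqnn N))].
  rewrite /= nuT ltr_norml => /andP[_ h]; exists (- N%:R); lra.
- have /cvgrPdist_lt : (fun k => nu `](k%:R : R), +oo[%classic) @ \oo --> nu set0.
    apply: cvgnu => //; apply: aeW => y; apply: cvg_near_cst.
    have := nbhs_infty_gtr y; apply: filterS => k hk.
    rewrite indic0 indicE memNset//= in_itv/= andbT.
    by apply/negP; rewrite -leNgt ltW.
  move=> /(_ c c0) [N _ /(_ N (leqnn N))].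
  rewrite /= nu0 ltr_norml => /andP[h _]; exists N%:R; lra.
Qed.

(** * Integrals of products with bounded functions *)

Lemma integrable_mulr_le1 (d : measure_display) (T : measurableType d)
    (R : realType) (mu : {measure set T -> \bar R}) (h f : T -> R) :
  measurable_fun [set: T] h -> (forall z, `|h z| <= 1) ->
  mu.-integrable setT (EFin \o f) ->
  mu.-integrable setT (fun z => (h z * f z)%:E).
Proof.
move=> mh h1 intf; apply: (le_integrable measurableT _ _ intf).
  apply/measurable_EFinP/measurable_funM => //.
  exact/measurable_EFinP/(measurable_int mu).
by move=> z _; rewrite /= lee_fin normrM ler_piMl.
Qed.

(* Dominated convergence along simple functions approximating [h]. *)
Lemma integral_mul_comp_eq0 (d d' : measure_display) (T : measurableType d)
    (U : measurableType d') (R : realType) (mu : {measure set T -> \bar R})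
    (phi : T -> U) (D : T -> R) (h : U -> R) :
  measurable_fun [set: T] phi -> mu.-integrable setT (EFin \o D) ->
  (forall G, measurable G -> (\int[mu]_(z in phi @^-1` G) (D z)%:E = 0)%E) ->
  measurable_fun [set: U] h -> (forall u, 0 <= h u <= 1) ->
  (\int[mu]_z (h (phi z) * D z)%:E = 0)%E.
Proof.
move=> mphi iD D0 mh h01.
have mD : measurable_fun [set: T] D by apply/measurable_EFinP/(measurable_int mu).
have mh' : measurable_fun [set: U] (EFin \o h) by exact/measurable_EFinP.
have h0 u : (0 <= (EFin \o h) u)%E by rewrite lee_fin; case/andP: (h01 u).
pose s := nnsfun_approx measurableT mh'.
have s_le k u : s k u <= h u.
  by rewrite -lee_fin /s nnsfun_approxE; exact: (le_approx (D := setT)).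
have ms k : measurable_fun [set: T] (fun z => s k (phi z)).
  by apply: measurableT_comp.
have iID k y : mu.-integrable setT
    (fun z => (\1_(s k @^-1` [set y]) (phi z) * D z)%:E).
  apply: integrable_mulr_le1 => // [|z].
    by apply: measurableT_comp => //; exact: measurable_indic.
  by rewrite indicE; case: (_ \in _); rewrite ?normr1 ?normr0.
(* A simple function is a finite combination of indicators of its level sets, and [D0] applies to
   the preimage of each under [phi]. *)
have int_s k : (\int[mu]_z (s k (phi z) * D z)%:E = 0)%E.
  under eq_integral.
    move=> z _; rewrite fimfunE fsbig_finite//= mulr_suml -sumEFin.
    over.
  rewrite integral_sum//.
    rewrite big1// => y _.
    under eq_integral do rewrite -mulrA EFinM.
    rewrite integralZl//.
    have -> : (\int[mu]_z (\1_(s k @^-1` [set y]) (phi z) * D z)%:E =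
        \int[mu]_(z in phi @^-1` (s k @^-1` [set y])) (D z)%:E)%E.
      rewrite [RHS]integral_mkcond; apply: eq_integral => z _.
      rewrite patchE indicE (_ : (z \in _) = (phi z \in s k @^-1` [set y]))//.
      by case: (_ \in _); rewrite ?mul1r ?mul0r.
    by rewrite D0 ?mule0//; exact: measurable_sfunP.
  by move=> y; under eq_fun do rewrite -mulrA EFinM; exact: integrableZl.
have [|||||/= _ _] := @dominated_convergence _ _ _ mu setT measurableT
  (fun k z => (s k (phi z) * D z)%:E) (fun z => (h (phi z) * D z)%:E)
  (fun z => (`|D z|)%:E).
- by move=> k; apply/measurable_EFinP/measurable_funM.
- by apply/measurable_EFinP/measurable_funM => //; exact: measurableT_comp.
- apply: aeW => z _; apply: cvg_EFin; first exact: nearW.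
  apply: (@cvgM _ _ _ _ _ (fun=> D z)); last exact: cvg_cst.
  exact/(fine_cvg (cvg_nnsfun_approx measurableT mh' (fun u _ => h0 u) I)).
- exact: integrable_norm.
- apply: aeW => z k _; rewrite /= lee_fin normrM ler_piMl//.
  rewrite ger0_norm//; apply: le_trans (s_le k _) _.
  by case/andP: (h01 (phi z)).
under eq_fun do rewrite int_s.
by move=> /(cvg_unique _ (cvg_cst 0%E)) => <-.
Qed.

Lemma descends_through_affine (R : realType) (c b k : R) (G : R -> R) :
  0 < k -> descends_through c G -> descends_through c (fun t => G (b + t / k)).
Proof.
move=> k0 [cG dG [l hl] [u hu]]; split.
- move=> t; rewrite /continuous_at; apply: continuous_cvg; first exact: cG.
  by apply: cvgD; [exact: cvg_cst|apply: cvgM; [exact: cvg_id|exact: cvg_cst]].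
- by move=> t t' tt'; apply: dG; rewrite lerD2l ler_pM2r// invr_gt0.
- by exists ((l - b) * k); rewrite mulfK ?gt_eqF// addrC subrK.
- by exists ((u - b) * k); rewrite mulfK ?gt_eqF// addrC subrK.
Qed.

(** * Rates and risks of classifiers as integrals against [P] *)

Section fair_classification.
Context (R : realType) (d : measure_display) (X : measurableType d) (n : nat).
Variables (P : probability (X * 'I_n.+1 * bool)%type R).
Variables (eta : 'I_n.+1 -> X -> R).
Hypothesis p_gt0 : forall a : 'I_n.+1, 0 < group_prob P a.
Hypothesis eta_regression : is_regression P eta.

Let Z := (X * 'I_n.+1 * bool)%type.
Let Y (z : Z) : R := z.2%:R.

Let measurable_group a : measurable [set z : Z | z.1.2 = a].
Proof.
rewrite [X in measurable X](_ : _ = (snd \o fst) @^-1` [set a])//.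
rewrite -[X in measurable X]setTI.
exact: (measurableT_comp measurable_snd measurable_fst).
Qed.

Let measurable_Y : measurable_fun [set: Z] Y.
Proof.
by apply: (@measurableT_comp _ _ _ _ _ _ (fun b : bool => b%:R : R)).
Qed.

Let measurable_eta : measurable_fun [set: Z] (fun z => eta z.1.2 z.1.1).
Proof.
have [meta _ _] := eta_regression.
by apply: (measurableT_comp meta measurable_fst).
Qed.

Let measurable_classifier (f : X * 'I_n.+1 -> R) : classifier f ->
  measurable_fun [set: Z] (fun z => f z.1).
Proof. by move=> [mf _]; apply: (measurableT_comp mf measurable_fst). Qed.

Let norm_classifier (f : X * 'I_n.+1 -> R) xa : classifier f -> `|f xa| <= 1.
Proof. by move=> [_ /(_ xa) /andP[f0 f1]]; rewrite ger0_norm. Qed.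

Let integrable_le1 (f : Z -> R) : measurable_fun [set: Z] f ->
  (forall z, `|f z| <= 1) -> P.-integrable setT (EFin \o f).
Proof.
move=> mf f1.
rewrite (_ : EFin \o f = fun z => (f z * 1)%:E); last first.
  by apply/funext => z; rewrite mulr1.
apply: (integrable_mulr_le1 (f := fun=> 1)) => //.
exact: finite_measure_integrable_cst.
Qed.

Let integrable_Y : P.-integrable setT (EFin \o Y).
Proof.
by apply: integrable_le1 => // z; rewrite /Y; case: z.2; rewrite ?normr1 ?normr0.
Qed.

Let integrable_eta : P.-integrable setT (EFin \o (fun z => eta z.1.2 z.1.1)).
Proof. by case: eta_regression. Qed.

(** Summing over the two Bernoulli outcomes removes the prediction coordinate, so that rates and
    risks become integrals against [P] alone. *)
Lemma pred_lawE (f : X * 'I_n.+1 -> R) (W : set (Z * bool)) : classifier f ->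
  pred_law P f W =
  (\int[P]_z (f z.1 * \1_W (z, true) + (1 - f z.1) * \1_W (z, false))%:E)%E.
Proof.
move=> [_ f01]; rewrite /pred_law /kproduct_snd /kproduct.
apply: eq_integral => z _; rewrite /kernel.intker_indic /=.
have := integral_bernoulli_prob (f01 z.1) (f := fun b => (\1_W (z, b))%:E).
by move=> ->.
Qed.

Lemma group_rateE (f : X * 'I_n.+1 -> R) (a : 'I_n.+1) : classifier f ->
  cond_prob (pred_law P f) [set w | w.2 = true] [set w | w.1.1.2 = a] =
  (\int[P]_z (f z.1 * \1_[set z : Z | z.1.2 = a] z)) / group_prob P a.
Proof.
move=> cf; rewrite /cond_prob !pred_lawE//; congr (fine _ / _).
  apply: eq_integral => z _; congr EFin; rewrite !indicE.
  rewrite (_ : ((z, false) \in _) = false) ?mulr0 ?addr0; last first.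
    by apply/negbTE/negP; rewrite inE/= => -[].
  congr (_ * (nat_of_bool _)%:R); apply/idP/idP; rewrite !inE/=; first by case.
  by move=> ->.
(* The group event ignores the prediction, so the weights [f] and [1 - f] add up to 1. *)
rewrite /group_prob -[X in P X]setIT -integral_indic//; congr fine.
apply: eq_integral => z _; congr EFin; rewrite !indicE/=.
have E b : ((z, b) \in [set w : Z * bool | w.1.1.2 = a]) =
    (z \in [set z : Z | z.1.2 = a]) by apply/idP/idP; rewrite !inE.
by rewrite !E -mulrDl addrC subrK mul1r.
Qed.

(** The defining property of [eta] says that [Y - eta] integrates to 0 over every event determined
    by [(X, A)]; this extends from indicators to [h]. *)
Lemma regression_orthogonal (h : X * 'I_n.+1 -> R) : classifier h ->
  (\int[P]_z (h z.1 * (Y z - eta z.1.2 z.1.1))%:E = 0)%E.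
Proof.
move=> [mh h01]; have [meta _ regP] := eta_regression.
apply: (integral_mul_comp_eq0 (phi := fst)
  (D := fun z => Y z - eta z.1.2 z.1.1)) => //.
  exact: integrableB integrable_Y integrable_eta.
move=> G mG; have mG' : measurable (fst @^-1` G : set Z).
  by rewrite -[X in measurable X]setTI; exact: measurable_fst.
have iY := integrableS measurableT mG' (@subsetT _ _) integrable_Y.
have ie := integrableS measurableT mG' (@subsetT _ _) integrable_eta.
have mS : measurable [set z : Z | z.2 = true].
  rewrite [X in measurable X](_ : _ = snd @^-1` [set true])//.
  by rewrite -[X in measurable X]setTI; exact: measurable_snd.
rewrite integralB_EFin// -regP//.
have -> : (\int[P]_(z in fst @^-1` G) (Y z)%:E =
    P [set z | G z.1 /\ z.2 = true])%E.
  rewrite (_ : [set z | _ /\ _] = [set z : Z | z.2 = true] `&` fst @^-1` G);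
    last by rewrite setIC.
  rewrite -integral_indic//; apply: eq_integral => z _; congr EFin.
  by rewrite indicE /Y; congr (nat_of_bool _)%:R; apply/idP/idP; rewrite inE.
by rewrite subee// fin_num_measure//; exact: measurableI.
Qed.

Let integrable_risk (f : X * 'I_n.+1 -> R) : classifier f ->
  P.-integrable setT (fun z => (Y z + f z.1 * (1 - 2 * eta z.1.2 z.1.1))%:E).
Proof.
move=> cf; have mf := measurable_classifier cf.
have ie := integrable_mulr_le1 mf (fun z => norm_classifier z.1 cf) integrable_eta.
have i1 := integrable_le1 mf (fun z => norm_classifier z.1 cf).
rewrite (_ : (fun z => _) = (fun z => (Y z)%:E +
  ((f z.1)%:E - 2%:E * (f z.1 * eta z.1.2 z.1.1)%:E))%E); last first.
  by apply/funext => z; rewrite -EFinM -EFinB -EFinD; congr EFin; ring.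
apply: integrableD => //; apply: integrableB => //; exact: integrableZl.
Qed.

(** Given [z], the error probability is [Y + f (1 - 2 Y)], that is [Y + f (1 - 2 eta)] minus
    [2 f (Y - eta)]; the last term has mean 0 by orthogonality. *)
Lemma misclassificationE (f : X * 'I_n.+1 -> R) : classifier f ->
  misclassification P f =
  (\int[P]_z (Y z + f z.1 * (1 - 2 * eta z.1.2 z.1.1))%:E)%E.
Proof.
move=> cf; rewrite /misclassification pred_lawE//.
have mf := measurable_classifier cf.
have iD : P.-integrable setT
    (fun z => (f z.1 * (Y z - eta z.1.2 z.1.1))%:E).
  apply: (integrable_mulr_le1 mf (fun z => norm_classifier z.1 cf)).
  exact: integrableB integrable_Y integrable_eta.
have iM := integrable_risk cf.
transitivity (\int[P]_z ((Y z + f z.1 * (1 - 2 * eta z.1.2 z.1.1))%:E +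
    (- 2)%:E * (f z.1 * (Y z - eta z.1.2 z.1.1))%:E))%E.
  apply: eq_integral => -[xa y] _; rewrite -EFinM -EFinD; congr EFin.
  rewrite !indicE /Y/=.
  have -> : (((xa, y), true) \in [set w : Z * bool | w.1.2 <> w.2]) = ~~ y.
    by apply/idP/idP; rewrite inE/=; case: y.
  have -> : (((xa, y), false) \in [set w : Z * bool | w.1.2 <> w.2]) = y.
    by apply/idP/idP; rewrite inE/=; case: y.
  by case: y => /=; ring.
rewrite integralD//; last exact: integrableZl.
by rewrite integralZl// regression_orthogonal// mule0 adde0.
Qed.

Let group_sumE (f : X * 'I_n.+1 -> R) (c : 'I_n.+1 -> R) (z : Z) :
  (f z.1 * c z.1.2)%:E = (\sum_(a < n.+1)
    (c a)%:E * (f z.1 * \1_[set z : Z | z.1.2 = a] z)%:E)%E.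
Proof.
under eq_bigr do rewrite -EFinM.
rewrite sumEFin; congr EFin; rewrite (bigD1 z.1.2)//= big1 => [|a az].
  by rewrite addr0 indicE mem_set// mulr1 mulrC.
by rewrite indicE memNset ?mulr0//= => E; rewrite E eqxx in az.
Qed.

Let integrable_group (f : X * 'I_n.+1 -> R) a : classifier f ->
  P.-integrable setT (fun z => (f z.1 * \1_[set z : Z | z.1.2 = a] z)%:E).
Proof.
move=> cf; have mf := measurable_classifier cf.
apply: (integrable_mulr_le1 mf (fun z => norm_classifier z.1 cf)).
exact: integrable_indic.
Qed.

Let integrable_weighted (f : X * 'I_n.+1 -> R) (c : 'I_n.+1 -> R) : classifier f ->
  P.-integrable setT (fun z => (f z.1 * c z.1.2)%:E).
Proof.
move=> cf; under eq_fun do rewrite group_sumE.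
apply: integrable_sum => // a _.
by apply: integrableZl => //; exact: integrable_group.
Qed.

Lemma parity_weighted_mean0 (f : X * 'I_n.+1 -> R) (t : 'I_n.+1 -> R) :
  classifier f -> demographic_parity P f -> \sum_(a < n.+1) t a = 0 ->
  (\int[P]_z (f z.1 * (t z.1.2 / group_prob P z.1.2))%:E = 0)%E.
Proof.
move=> cf dpf t0.
pose g a (z : Z) := f z.1 * \1_[set z : Z | z.1.2 = a] z.
have ig a : P.-integrable setT (EFin \o g a) by exact: integrable_group.
(* The common rate is that of the reference group; it factors out of the sum over groups and leaves
   the sum of the [t a]. *)
have rate a : (\int[P]_z g a z) / group_prob P a =
    (\int[P]_z g ord0 z) / group_prob P ord0.
  have [->|a0] := eqVneq a ord0; first by [].
  by move: (dpf a a0); rewrite (group_rateE a cf) (group_rateE ord0 cf).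
under eq_integral do
  rewrite (group_sumE _ (fun a => t a / group_prob P a)).
rewrite integral_sum//; last first.
  by move=> a; apply: integrableZl => //; exact: ig.
under eq_bigr => a _.
  rewrite (integralZl measurableT (ig a)) -[X in (_ * X)%E]fineK; last first.
    exact: integrable_fin_num (ig a).
  rewrite -EFinM mulrAC -mulrA.
  rewrite -[X in _ * X]/(\int[P]_z g a z / group_prob P a) rate.
  over.
by rewrite sumEFin -mulr_suml t0 mul0r.
Qed.

(* The Lagrangian: demographic parity makes the multiplier terms vanish. *)
Lemma misclassification_parityE (f : X * 'I_n.+1 -> R) (t : 'I_n.+1 -> R) :
  classifier f -> demographic_parity P f -> \sum_(a < n.+1) t a = 0 ->
  misclassification P f = (\int[P]_z (Y z +
    f z.1 * (1 - 2 * eta z.1.2 z.1.1 + t z.1.2 / group_prob P z.1.2))%:E)%E.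
Proof.
move=> cf dpf t0; rewrite misclassificationE// -[LHS]adde0.
rewrite -(parity_weighted_mean0 cf dpf t0) -integralD//.
- by apply: eq_integral => z _; rewrite -EFinD; congr EFin; ring.
- exact: integrable_risk.
- exact: (integrable_weighted (fun a => t a / group_prob P a)).
Qed.

(** With the same multipliers in both risks, the integrands can be compared pointwise: the
    coefficient of the classifier is negative exactly where [f] is 1. *)
Lemma threshold_optimal (f : X * 'I_n.+1 -> R) (t : 'I_n.+1 -> R) :
  classifier f -> demographic_parity P f -> \sum_(a < n.+1) t a = 0 ->
  (forall x a, f (x, a) =
    if eta a x > 1 / 2 + t a / (2 * group_prob P a) then 1 else 0) ->
  fair_bayes_optimal P f.
Proof.
move=> cf dpf t0 fE; split; [exact: cf|exact: dpf|move=> g cg dpg].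
have iL h : classifier h -> P.-integrable setT (fun z => (Y z +
    h z.1 * (1 - 2 * eta z.1.2 z.1.1 + t z.1.2 / group_prob P z.1.2))%:E).
  move=> ch; rewrite (_ : (fun z => _) =
    (fun z => (Y z + h z.1 * (1 - 2 * eta z.1.2 z.1.1))%:E +
      (h z.1 * (t z.1.2 / group_prob P z.1.2))%:E)%E); last first.
    by apply/funext => z; rewrite -EFinD; congr EFin; ring.
  apply: integrableD => //; first exact: integrable_risk.
  exact: (integrable_weighted (fun a => t a / group_prob P a)).
rewrite (misclassification_parityE cf dpf t0) (misclassification_parityE cg dpg t0).
apply: le_integral => //; [exact: iL|exact: iL|].
move=> [[x a] y] _; rewrite lee_fin lerD2l fE/=.
have /andP[g0 g1] := cg.2 (x, a).
have -> : 1 - 2 * eta a x + t a / group_prob P a =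
    - 2 * (eta a x - (1 / 2 + t a / (2 * group_prob P a))).
  by field; rewrite gt_eqF.
by case: ltP => h; nra.
Qed.

Lemma threshold_classifier (c : 'I_n.+1 -> R) :
  classifier (fun xa : X * 'I_n.+1 => if c xa.2 < eta xa.2 xa.1 then 1 else 0 : R).
Proof.
have [meta _ _] := eta_regression.
split; last by move=> xa; case: ifP; rewrite ?lexx ?ler01.
apply: measurable_fun_if => //; apply: measurable_fun_ltr => //.
exact: (measurableT_comp _ measurable_snd).
Qed.

(** Links the integral form of the group rates to the tail probabilities that the thresholds
    equalize. *)
Lemma threshold_rateE (c : 'I_n.+1 -> R) (a : 'I_n.+1) :
  (\int[P]_z ((if c z.1.2 < eta z.1.2 z.1.1 then 1 else 0) *
    \1_[set z : Z | z.1.2 = a] z)) / group_prob P a =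
  cond_law P a [set x | eta a x > c a].
Proof.
rewrite /cond_law /cond_prob; congr (_ / _); rewrite -[X in P X]setIT.
rewrite -integral_indic//.
  congr fine; apply: eq_integral => z _; congr EFin; rewrite !indicE.
  have [za|za] := pselect (z.1.2 = a); last first.
    rewrite !memNset ?mulr0//=; by case.
  rewrite [in X in _ * X]mem_set// mulr1 za.
  case: ifPn => h; first by rewrite mem_set.
  by rewrite memNset//= => -[]; rewrite (negbTE h).
have mf := measurable_classifier (threshold_classifier c).
(* Within the group the event is the preimage of 1 under the threshold classifier, whose
   measurability is known. *)
rewrite (_ : _ `&` _ = (fun z : Z => if c z.1.2 < eta z.1.2 z.1.1 then 1 else 0 : R)
  @^-1` [set 1] `&` [set z | z.1.2 = a]); last first.
  apply/seteqP; split=> [z /= [h za]|z /= [+ za]].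
    by split => //; rewrite za h.
  by rewrite za; case: ifP => // _ /eqP; rewrite eq_sym oner_eq0.
apply: measurableI => //; rewrite -[X in measurable X]setTI.
exact: mf.
Qed.

End fair_classification.

(** * Choice of the thresholds and conclusion *)

Lemma threshold_tail_descends (R : realType) (d : measure_display)
    (X : measurableType d) (n : nat)
    (P : probability (X * 'I_n.+1 * bool)%type R)
    (eta : 'I_n.+1 -> X -> R) (a : 'I_n.+1) (c : R) :
  0 < group_prob P a ->
  has_pdf (fun B : set R => cond_law P a [set x | B (eta a x)]) ->
  0 < c < 1 ->
  descends_through c
    (fun t => cond_law P a
      [set x | eta a x > 1 / 2 + t / (2 * group_prob P a)]).
Proof.
move=> pa0 pdf c01.
have pT : cond_law P a [set x | [set: R] (eta a x)] = 1.
  rewrite /cond_law /cond_prob (_ : _ `&` _ = [set z | z.1.2 = a]).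
    by rewrite divff// gt_eqF.
  by apply/seteqP; split=> [z []|z].
have := has_pdf_tail_descends pdf pT c01.
move=> /(descends_through_affine (1 / 2) (mulr_gt0 (@ltr0n R 2) pa0)).
congr descends_through; apply/funext => t; congr cond_law.
by apply/seteqP; split=> x /=; rewrite in_itv/= andbT.
Qed.

Theorem theorem4p10 (R : realType) (d : measure_display)
    (X : measurableType d) (n : nat)
    (P : probability (X * 'I_n.+1 * bool)%type R)
    (eta : 'I_n.+1 -> X -> R)
    (card_gt2 : (2 < n.+1)%N)
    (p_gt0 : forall a : 'I_n.+1, 0 < group_prob P a)
    (eta_regression : is_regression P eta)
    (eta_pdf : forall a : 'I_n.+1,
       has_pdf (fun B : set R => cond_law P a [set x | B (eta a x)])) :
  exists t : 'I_n.+1 -> R,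
    [/\ \sum_(a < n.+1) t a = 0,
        forall a : 'I_n.+1, a != ord0 ->
          cond_law P a
            [set x | eta a x > 1 / 2 + t a / (2 * group_prob P a)] =
          cond_law P ord0
            [set x | eta ord0 x > 1 / 2 + t ord0 / (2 * group_prob P ord0)] &
        exists f : X * 'I_n.+1 -> R,
          fair_bayes_optimal P f /\
          forall (x : X) (a : 'I_n.+1),
            f (x, a) =
            (if eta a x > 1 / 2 + t a / (2 * group_prob P a) then 1 else 0)].
Proof.
(* Any level strictly between 0 and 1 would do; it only anchors the intermediate value argument and
   is not the final common rate. *)
have half01 : 0 < (1 / 2 : R) < 1 by apply/andP; split; lra.
have dG a := threshold_tail_descends (p_gt0 a) (eta_pdf a) half01.
have [H _ /(_ 0)[t t0 tH]] := descends_through_level dG.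
exists t; split => //; first by move=> a _; rewrite !tH.
pose c a := 1 / 2 + t a / (2 * group_prob P a).
pose f (xa : X * 'I_n.+1) : R := if c xa.2 < eta xa.2 xa.1 then 1 else 0.
have cf : classifier f by exact: (threshold_classifier eta_regression c).
exists f; split; last by [].
(* What remains is parity of [f]: each group rate is a tail probability equal to [H 0]. *)
apply: (threshold_optimal p_gt0 eta_regression cf _ t0) => [a _|x a]; last by [].
rewrite (group_rateE P a cf) (group_rateE P ord0 cf).
by rewrite !(threshold_rateE eta_regression) !tH.
Qed.
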